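(* The sequences of orthogonal polynomials $\{\bar q_n\}_{n\ge0}$ and $\{q_n\}_{n\ge0}$ are not classical.
   Context: The sequence $\{q_n\}_{n\ge 0}$ of polynomials in $x$ is defined by $q_{-1}=0$, $q_0=1$ and $$4(n+1)x\,q_n=(2n+5)q_{n+1}+(2n-1)q_{n-1},\qquad n\ge0,$$ so $q_1=\frac{4x}{5}$, $q_2=\frac{32x^2-5}{35}$, $q_3=\frac{16}{105}x(8x^2-3)$. The sequence $\{\bar q_n\}_{n\ge0}$ of polynomials in $x$ is defined by $\bar q_{-1}=0$, $\bar q_0=\frac15$ and $$4(n+2)x\,\bar q_n=(2n+7)\bar q_{n+1}+(2n+1)\bar q_{n-1},\qquad n\ge0,$$ so $\bar q_1=\frac{8x}{35}$, $\bar q_2=\frac{32x^2-7}{105}$, $\bar q_3=\frac{8x(64x^2-29)}{1155}$. Each sequence has $n$-th term of degree $n$ and is orthogonal with respect to a weight $w$ (positive measure) on $\mathbb R$. Write $(p,q)=\int p\,\overline{q}\,dw$ for $p,q\in\mathbb C[x]$. A sequence $\{p_n\}_{n\ge0}$ of orthogonal polynomials with weight $w$ is called classical if there exists a second order differential operator $D$ in $x$ with complex polynomial coefficients that is symmetric, i.e. $(Dp,q)=(p,Dq)$ for all $p,q\in\mathbb C[x]$, and such that $Dp_n=\gamma_np_n$ with $\gamma_n\in\mathbb C$ for all $n\ge0$. *)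

(* Defs.v *)
From HB Require Import structures.
From mathcomp Require Import all_boot all_order all_algebra.
From mathcomp Require Import all_classical all_reals all_analysis.
From mathcomp Require Import complex.

Set Implicit Arguments.
Unset Strict Implicit.
Unset Printing Implicit Defensive.

Import Order.TTheory GRing.Theory Num.Theory.

Local Open Scope ring_scope.

Section Sequences.
Variable F : numFieldType.
Implicit Types (n : nat).

(* The recursion carries the pair (p_n, p_{n-1}), starting from
   (p_0, p_{-1}) with p_{-1} = 0. *)
Fixpoint q_pair n : {poly F} * {poly F} :=
  if n is m.+1 then
    let: (qm, qm1) := q_pair m in
    ((2 * m%:R + 5)^-1 *:
       ((4 * (m%:R + 1)) *: ('X * qm) - (2 * m%:R - 1) *: qm1), qm)
  else (1, 0).

Definition q_seq n : {poly F} := (q_pair n).1.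

Fixpoint qbar_pair n : {poly F} * {poly F} :=
  if n is m.+1 then
    let: (qm, qm1) := qbar_pair m in
    ((2 * m%:R + 7)^-1 *:
       ((4 * (m%:R + 2)) *: ('X * qm) - (2 * m%:R + 1) *: qm1), qm)
  else ((5^-1)%:P, 0).

Definition qbar_seq n : {poly F} := (qbar_pair n).1.

Lemma q_rec n : (4 * (n%:R + 1)) *: ('X * q_seq n) =
  (2 * n%:R + 5) *: q_seq n.+1 + (2 * n%:R - 1) *:
  (if n is m.+1 then q_seq m else 0).
Proof.
have -> : (if n is m.+1 then q_seq m else 0) = (q_pair n).2.
  by case: n => [|n] //=; rewrite /q_seq; case: (q_pair n).
rewrite /q_seq /=; case: (q_pair n) => a b /=.
rewrite scalerA divff ?scale1r ?subrK; first by [].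
by rewrite gt_eqF // ltr_wpDl // mulr_ge0.
Qed.

Lemma qbar_rec n : (4 * (n%:R + 2)) *: ('X * qbar_seq n) =
  (2 * n%:R + 7) *: qbar_seq n.+1 + (2 * n%:R + 1) *:
  (if n is m.+1 then qbar_seq m else 0).
Proof.
have -> : (if n is m.+1 then qbar_seq m else 0) = (qbar_pair n).2.
  by case: n => [|n] //=; rewrite /qbar_seq; case: (qbar_pair n).
rewrite /qbar_seq /=; case: (qbar_pair n) => a b /=.
rewrite scalerA divff ?scale1r ?subrK; first by [].
by rewrite gt_eqF // ltr_wpDl // mulr_ge0.
Qed.

End Sequences.

Section Orthogonality.
Variable R : realType.
Local Notation C := R[i].
Implicit Types (w : {measure set (measurableTypeR R) -> \bar R}).

Definition finite_moments w :=
  forall n : nat, w.-integrable setT (fun x : R => (x ^+ n)%:E).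

Definition Cintegral w (f : R -> C) : C :=
  Complex (Rintegral w setT (fun x => complex.Re (f x)))
          (Rintegral w setT (fun x => complex.Im (f x))).

Definition inner w (u v : {poly C}) : C :=
  Cintegral w (fun x => u.[x%:C%C] * (v.[x%:C%C])^*%C).

Definition orthogonal_polys w (p : nat -> {poly C}) : Prop :=
  [/\ finite_moments w,
      forall n, size (p n) = n.+1,
      forall m n, m <> n -> inner w (p m) (p n) = 0
    & forall n, inner w (p n) (p n) != 0].

Definition diffop2 (a2 a1 a0 u : {poly C}) : {poly C} :=
  a2 * u^`(2) + a1 * u^`() + a0 * u.

Definition symmetric_op w (D : {poly C} -> {poly C}) : Prop :=
  forall u v : {poly C}, inner w (D u) v = inner w u (D v).

(* [a2 != 0] makes the operator genuinely of order two; without it, D = 0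
   would make every orthogonal sequence classical. *)
Definition classical w (p : nat -> {poly C}) : Prop :=
  exists a2 a1 a0 : {poly C},
    [/\ a2 != 0, symmetric_op w (diffop2 a2 a1 a0)
      & exists gamma : nat -> C,
          forall n, diffop2 a2 a1 a0 (p n) = gamma n *: p n].

End Orthogonality.

(* Main.v *)
Require Import Defs.
From HB Require Import structures.
From mathcomp Require Import all_boot all_order all_algebra.
From mathcomp Require Import all_classical all_reals all_analysis.
From mathcomp Require Import complex.
From mathcomp Require Import ring.

Set Implicit Arguments.
Unset Strict Implicit.
Unset Printing Implicit Defensive.

Import GRing.Theory Num.Theory.

Local Open Scope ring_scope.

(** Neither sequence consists of eigenpolynomials of a differential operator of
    order two, whatever the measure: the eigenvalue equations in degrees 0 to 4
    already force the leading coefficient [a2] to vanish, by the computation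
    behind Bochner's theorem.

    The two sequences have alternating parity, so up to nonzero factors their
    first members are [1], [X], [X^2 - t], [X^3 - s X], [X^4 - u X^2 + v].
    Degree 0 makes [a0] a constant, which can be subtracted from the operator;
    degree 1 then gives [a1 = c X] and degree 2 gives
    [a2 = b X^2 - t (b + c)].  Only the two numbers [b] and [c] are left.  In
    each of the degrees 3 and 4 the leading coefficient determines the
    eigenvalue, and the next coefficient yields the homogeneous linear equations
    [3 t (b + c) = s (3 b + c)] and [6 t (b + c) = u (5 b + c)].
    Their determinant is a multiple of [6 t (u - s) - s u]; when it is nonzero,
    [b = c = 0] and so [a2 = 0].  This is [reduced_operator_eq0], and
    [bochner_low_degrees] adds the reduction to [a0 = 0] and [a1 = c X].

    The recurrences give [(t, s, u) = (5/32, 3/8, 39/64)] for [q_seq]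
    ([q_seqE]) and [(7/32, 29/64, 111/160)] for [qbar_seq] ([qbar_seqE]); the
    quantity [6 t (u - s) - s u] is [-9/1024] and [3/2048] respectively. *)

Lemma eq_sub0 (V : zmodType) (x y : V) : x = y -> x - y = 0.
Proof. by move->; rewrite subrr. Qed.

(** The condition on [t], [s], [u] holds exactly when the equations coming from
    degrees 3 and 4 determine [b] and [c].  It fails for families such as the
    Jacobi polynomials with equal parameters, for which a nonzero [a] exists. *)
Lemma reduced_operator_eq0 (F : numFieldType) (a : {poly F})
    (t s u v c d2 d3 d4 : F) (D := fun p => a * p^`(2) + (c *: 'X) * p^`()) :
    6 * t * (u - s) != s * u ->
    D ('X^2 - t%:P) = d2 *: ('X^2 - t%:P) ->
    D ('X^3 - s *: 'X) = d3 *: ('X^3 - s *: 'X) ->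
    D ('X^4 - u *: 'X^2 + v%:P) = d4 *: ('X^4 - u *: 'X^2 + v%:P) ->
  a = 0.
Proof.
rewrite {}/D => det; cbv beta.
rewrite !(derivnS, derivn0).
rewrite !(derivB, derivD, derivZ, derivMn, derivXn, derivX, derivC) /=.
rewrite -!mul_polyC expr0 expr1 => /eq_sub0 e2 /eq_sub0 e3 /eq_sub0 e4.
(* With [b] the coefficient of X^2 in [a], degree 2 reads [d2 = 2 m]. *)
pose b := d2 / 2 - c; pose m := b + c.
have aE : a = b%:P * 'X^2 - (t * m)%:P.
  have d2E : d2 = 2 * m by rewrite /m /b; field.
  apply/(@mulfI _ 2); first by rewrite -polyC_natr polyC_eq0 pnatr_eq0.
  (* Replacing a 0 by the difference of the two sides of an eigenvalue equation
     adds that equation to the goal. *)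
  apply/(addIr 0); rewrite -[in RHS]e2 d2E /m; ring.
(* In each of the two differences the top coefficient gives the eigenvalue, and
   the next one is a linear condition on [b] and [m]. *)
have f3 : (6 * b + 3 * c - d3)%:P * 'X^3
    + (d3 * s - 6 * t * m - c * s)%:P * 'X = 0 :> {poly F}.
  by rewrite -[RHS]e3 aE; ring.
have f4 : (12 * b + 4 * c - d4)%:P * 'X^4
    + (u * d4 - 12 * t * m - 2 * u * m)%:P * 'X^2 + (2 * u * t * m - d4 * v)%:P
    = 0 :> {poly F}.
  by rewrite -[RHS]e4 aE /m; ring.
have := congr1 (coefp 1) f3; have := congr1 (coefp 3) f3.
have := congr1 (coefp 2) f4; have := congr1 (coefp 4) f4.
rewrite /= !(coefD, coefCM, coefXn, coefX, coefC, coef0) /=.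
rewrite !(mulr0, mulr1, addr0, add0r).
move=> /subr0_eq <- r4 /subr0_eq <- r3.
(* Eliminating [b], then [m], from the two conditions multiplies the other
   unknown by [r]. *)
pose r := 6 * t * (u - s) - s * u.
have r0 : r != 0 by rewrite subr_eq0.
have m0 : m = 0.
  apply/(mulfI r0); rewrite mulr0 /r.
  have -> : (6 * t * (u - s) - s * u) * m =
      (s * (u * (12 * b + 4 * c) - 12 * t * m - 2 * u * m)
       - 2 * u * ((6 * b + 3 * c) * s - 6 * t * m - c * s)) / 2.
    by rewrite /m; field.
  by rewrite r3 r4 !mulr0 subr0 mul0r.
have b0 : b = 0.
  apply/(mulfI r0); rewrite mulr0 /r.
  have -> : (6 * t * (u - s) - s * u) * b =
      ((2 * u - 12 * t) * ((6 * b + 3 * c) * s - 6 * t * m - c * s)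
       - (2 * s - 6 * t) * (u * (12 * b + 4 * c) - 12 * t * m - 2 * u * m)) / 8.
    by rewrite /m; field.
  by rewrite r3 r4 !mulr0 subr0 mul0r.
by rewrite aE m0 b0 mulr0 polyC0 mul0r subrr.
Qed.

Section Eigen.
Variables (R : realType) (a2 a1 a0 : {poly R[i]}).
Implicit Types (p : {poly R[i]}) (k t s u v : R[i]).

Definition eigen p := exists g : R[i], diffop2 a2 a1 a0 p = g *: p.

Lemma diffop2Z k p : diffop2 a2 a1 a0 (k *: p) = k *: diffop2 a2 a1 a0 p.
Proof. by rewrite /diffop2 derivnZ derivZ -!scalerAr -!scalerDr. Qed.

Lemma eigenZ k p : k != 0 -> eigen (k *: p) <-> eigen p.
Proof.
move=> k0; split=> -[g e]; exists g.
  by apply: (scalerI k0); rewrite -diffop2Z e !scalerA mulrC.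
by rewrite diffop2Z e !scalerA mulrC.
Qed.

(** Degrees 0 and 1 fix [a0] and [a1]; subtracting the constant [a0] shifts every
    eigenvalue by [g0], which reduces to [reduced_operator_eq0]. *)
Lemma bochner_low_degrees t s u v :
    6 * t * (u - s) != s * u ->
    eigen 1 -> eigen 'X -> eigen ('X^2 - t%:P) ->
    eigen ('X^3 - s *: 'X) -> eigen ('X^4 - u *: 'X^2 + v%:P) ->
  a2 = 0.
Proof.
move=> det [g0 e0] [g1 e1] [g2 e2] [g3 e3] [g4 e4].
have a0E : a0 = g0%:P.
  move: e0; rewrite /diffop2 derivnS derivn1 derivC deriv0 !mulr0 !add0r mulr1.
  by rewrite alg_polyC.
have a1E : a1 = (g1 - g0) *: 'X.
  move: e1; rewrite /diffop2 derivnS derivn1 derivX derivC mulr0 add0r mulr1.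
  by rewrite a0E mul_polyC scalerBl => <-; rewrite addrK.
have reduce g p : diffop2 a2 a1 a0 p = g *: p ->
    a2 * p^`(2) + ((g1 - g0) *: 'X) * p^`() = (g - g0) *: p.
  by move=> e; rewrite [RHS]scalerBl -e /diffop2 a0E a1E mul_polyC addrK.
exact: (reduced_operator_eq0 det (reduce _ _ e2) (reduce _ _ e3) (reduce _ _ e4)).
Qed.

End Eigen.

Lemma q_seqE (F : numFieldType) :
  [/\ q_seq F 0 = 1, q_seq F 1 = (4 / 5) *: 'X,
      q_seq F 2 = (32 / 35) *: ('X^2 - (5 / 32)%:P),
      q_seq F 3 = (128 / 105) *: ('X^3 - (3 / 8) *: 'X)
    & q_seq F 4 = (2048 / 1155) *: ('X^4 - (39 / 64) *: 'X^2 + (75 / 2048)%:P)].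
Proof.
have step n : q_seq F n.+2 = (2 * n.+1%:R + 5)^-1 *:
    ((4 * (n.+1%:R + 1)) *: ('X * q_seq F n.+1) - (2 * n.+1%:R - 1) *: q_seq F n).
  by rewrite /q_seq /=; case: (q_pair F n).
have e0 : q_seq F 0 = 1 by [].
have e1 : q_seq F 1 = (4 / 5) *: 'X.
  by apply/polyP=> i; rewrite /q_seq /= mulr1 scaler0 subr0 !coefE; field.
have e2 : q_seq F 2 = (32 / 35) *: ('X^2 - (5 / 32)%:P).
  rewrite step e1 e0 -scalerAr -expr2; apply/polyP=> i; rewrite !coefE.
  by case: (i == 0)%N => /=; field.
have e3 : q_seq F 3 = (128 / 105) *: ('X^3 - (3 / 8) *: 'X).
  rewrite step e2 e1 -scalerAr mulrBr -exprS ['X * _%:P]mulrC mul_polyC.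
  by apply/polyP=> i; rewrite !coefE; field.
have e4 : q_seq F 4 = (2048 / 1155) *: ('X^4 - (39 / 64) *: 'X^2 + (75 / 2048)%:P).
  rewrite step e3 e2 -scalerAr mulrBr -exprS -scalerAr -expr2.
  apply/polyP=> i; rewrite !coefE.
  by case: (i == 0)%N => /=; field.
by [].
Qed.

Lemma qbar_seqE (F : numFieldType) :
  [/\ qbar_seq F 0 = 5^-1 *: 1, qbar_seq F 1 = (8 / 35) *: 'X,
      qbar_seq F 2 = (32 / 105) *: ('X^2 - (7 / 32)%:P),
      qbar_seq F 3 = (512 / 1155) *: ('X^3 - (29 / 64) *: 'X)
    & qbar_seq F 4 =
        (2048 / 3003) *: ('X^4 - (111 / 160) *: 'X^2 + (539 / 10240)%:P)].
Proof.
have step n : qbar_seq F n.+2 = (2 * n.+1%:R + 7)^-1 *: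
    ((4 * (n.+1%:R + 2)) *: ('X * qbar_seq F n.+1)
     - (2 * n.+1%:R + 1) *: qbar_seq F n).
  by rewrite /qbar_seq /=; case: (qbar_pair F n).
have e0 : qbar_seq F 0 = 5^-1 *: 1 by rewrite alg_polyC.
have e1 : qbar_seq F 1 = (8 / 35) *: 'X.
  rewrite /qbar_seq /= scaler0 subr0 ['X * _%:P]mulrC mul_polyC.
  by apply/polyP=> i; rewrite !coefE; field.
have e2 : qbar_seq F 2 = (32 / 105) *: ('X^2 - (7 / 32)%:P).
  rewrite step e1 e0 -scalerAr -expr2; apply/polyP=> i; rewrite !coefE.
  by case: (i == 0)%N => /=; field.
have e3 : qbar_seq F 3 = (512 / 1155) *: ('X^3 - (29 / 64) *: 'X).
  rewrite step e2 e1 -scalerAr mulrBr -exprS ['X * _%:P]mulrC mul_polyC.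
  by apply/polyP=> i; rewrite !coefE; field.
have e4 : qbar_seq F 4 =
    (2048 / 3003) *: ('X^4 - (111 / 160) *: 'X^2 + (539 / 10240)%:P).
  rewrite step e3 e2 -scalerAr mulrBr -exprS -scalerAr -expr2.
  apply/polyP=> i; rewrite !coefE.
  by case: (i == 0)%N => /=; field.
by [].
Qed.

Theorem theorem6p0p6 (R : realType) :
  (forall w : {measure set (measurableTypeR R) -> \bar R},
     orthogonal_polys w (qbar_seq R[i]) -> ~ classical w (qbar_seq R[i])) /\
  (forall w : {measure set (measurableTypeR R) -> \bar R},
     orthogonal_polys w (q_seq R[i]) -> ~ classical w (q_seq R[i])).
Proof.
have nz (m n : nat) : (0 < m)%N -> (0 < n)%N -> (m%:R / n%:R : R[i]) != 0.
  by move=> m0 n0; rewrite mulf_neq0 ?invr_eq0 ?pnatr_eq0 -?lt0n.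
split=> w _ [a2 [a1 [a0 [/eqP a2_neq0 _ [g Dg]]]]]; apply: a2_neq0.
- have [e0 e1 e2 e3 e4] := qbar_seqE R[i].
  have D n : eigen a2 a1 a0 (qbar_seq R[i] n) by exists (g n); exact: Dg.
  move: (D 0) (D 1) (D 2) (D 3) (D 4); rewrite e0 e1 e2 e3 e4.
  rewrite eigenZ ?invr_eq0 ?pnatr_eq0 // !eigenZ ?nz //.
  apply: bochner_low_degrees; rewrite -subr_eq0.
  by rewrite (_ : _ - _ = 3 / 2048) ?nz //; field.
- have [e0 e1 e2 e3 e4] := q_seqE R[i].
  have D n : eigen a2 a1 a0 (q_seq R[i] n) by exists (g n); exact: Dg.
  move: (D 0) (D 1) (D 2) (D 3) (D 4); rewrite e0 e1 e2 e3 e4 !eigenZ ?nz //.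
  apply: bochner_low_degrees; rewrite -subr_eq0.
  by rewrite (_ : _ - _ = - (9 / 1024)) ?oppr_eq0 ?nz //; field.
Qed.
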